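(* Let $f:\mathbb R^d\to\mathbb R$ be bounded and measurable with $|f(x)|=O(e^{-c|x|})$ as $|x|\to\infty$ for some $c\ge0$. Let $\sigma:\mathbb R\to\mathbb R$ be Lipschitz continuous, with $\sigma(0)=0$ if $c>0$. Suppose that the Lévy noise $\Lambda$ satisfies $m_\lambda(p)<\infty$ for some $1\le p<1+2/d$, and that $\rho=0$ if $p<2$. Let $Y$ be the mild solution to the stochastic heat equation. Then: (1) $\overline\gamma(p)<\infty$. (2) If $c>0$ and $\sigma(0)=0$, then $\overline\lambda(p)<\infty$.
   Context: Noise: on a filtered probability space, $$\Lambda(\mathrm dt,\mathrm dx)=b\,\mathrm dt\,\mathrm dx+\rho\,W(\mathrm dt,\mathrm dx)+\int_{\mathbb R}z\,(\mu-\nu)(\mathrm dt,\mathrm dx,\mathrm dz),$$ where $b,\rho\in\mathbb R$, $W$ is a Gaussian space--time white noise on $(0,\infty)\times\mathbb R^d$, $\mu$ is a Poisson random measure on $(0,\infty)\times\mathbb R^d\times\mathbb R$ with intensity $\nu(\mathrm dt,\mathrm dx,\mathrm dz)=\mathrm dt\,\mathrm dx\,\lambda(\mathrm dz)$, and $\lambda$ is a Lévy measure, i.e. $\lambda(\{0\})=0$, $\int_{\mathbb R}(1\wedge z^2)\,\lambda(\mathrm dz)<\infty$. Put $m_\lambda(p)=\left(\int_{\mathbb R}|z|^p\,\lambda(\mathrm dz)\right)^{1/p}$. Equation: for $\kappa>0$, let $g(t,x)=(2\pi\kappa t)^{-d/2}e^{-|x|^2/(2\kappa t)}$ and $Y_0(t,x)=\int_{\mathbb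 R^d}g(t,x-y)f(y)\,\mathrm dy$. A mild solution to $\partial_tY=\frac\kappa2\Delta Y+\sigma(Y)\dot\Lambda$, $Y(0,\cdot)=f$, is a predictable process $Y$ with $Y(t,x)=Y_0(t,x)+\int_0^t\int_{\mathbb R^d}g(t-s,x-y)\sigma(Y(s,y))\,\Lambda(\mathrm ds,\mathrm dy)$ for $(t,x)\in(0,\infty)\times\mathbb R^d$. Under the hypotheses of the claim there is $\beta_0>0$ such that there is a unique (up to modifications) mild solution $Y$ with $\sup_{t>0,x\in\mathbb R^d}e^{-\beta t+c|x|}\,\mathbb E[|Y(t,x)|^p]^{1/p}<\infty$ for all $\beta\ge\beta_0$; this is the solution $Y$ meant. Exponents: $$\overline\gamma(p)=\limsup_{t\to\infty}\frac1t\sup_{x\in\mathbb R^d}\log\mathbb E[|Y(t,x)|^p],\qquad \overline\lambda(p)=\inf\Big\{\alpha>0:\limsup_{t\to\infty}\frac1t\sup_{|x|\ge\alpha t}\log\mathbb E[|Y(t,x)|^p]<0\Big\},$$ with $\inf\emptyset=+\infty$. *)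

(* Defs.v *)
From HB Require Import structures.
From mathcomp Require Import all_boot all_order all_algebra.
From mathcomp Require Import all_classical all_reals all_analysis.
From mathcomp Require Import measurable_realfun.

Set Implicit Arguments.
Unset Strict Implicit.
Unset Printing Implicit Defensive.

Import Order.TTheory GRing.Theory Num.Theory.
Import numFieldNormedType.Exports.

Local Open Scope classical_set_scope.
Local Open Scope ring_scope.

(* R^d is represented by d.-tuple R: the library gives tuples the product
   (= Borel) sigma-algebra, which it does not do for row vectors, and the norm
   it puts on 'rV[R]_d is the sup norm rather than the Euclidean one. *)

Section lebesgue_Rd.
Context {R : realType}.

Definition consRd n (z : R * n.-tuple R) : n.+1.-tuple R := [tuple of z.1 :: z.2].

Lemma measurable_consRd n : measurable_fun setT (@consRd n).
Proof. exact: measurable_cons. Qed.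

Section step.
Variables (n : nat) (m : {sigma_finite_measure set (n.-tuple R) -> \bar R}).

Definition lebesgue_cons : set (n.+1.-tuple R) -> \bar R :=
  pushforward (lebesgue_measure \x m)%E (@consRd n).

Let lebesgue_cons0 : lebesgue_cons set0 = 0%E.
Proof. by rewrite /lebesgue_cons /pushforward preimage_set0 measure0. Qed.

Let lebesgue_cons_ge0 A : (0 <= lebesgue_cons A)%E.
Proof. exact: (measure_ge0 (lebesgue_measure \x m)%E). Qed.

Let measurable_consRdI A : measurable A -> measurable (@consRd n @^-1` A).
Proof. by move=> mA; rewrite -[X in measurable X]setTI; exact: measurable_consRd. Qed.

Let lebesgue_cons_sigma_additive : semi_sigma_additive lebesgue_cons.
Proof.
move=> F mF tF mUF; rewrite /lebesgue_cons /pushforward preimage_bigcup.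
apply: measure_semi_sigma_additive.
- by move=> k; exact: measurable_consRdI.
- apply/trivIsetP => /= i j _ _ ij; rewrite -preimage_setI.
  by move/trivIsetP : tF => /(_ _ _ _ _ ij) ->//; rewrite preimage_set0.
- by rewrite -preimage_bigcup; exact: measurable_consRdI.
Qed.

HB.instance Definition _ := isMeasure.Build _ _ _ lebesgue_cons
  lebesgue_cons0 lebesgue_cons_ge0 lebesgue_cons_sigma_additive.

Let lebesgue_cons_sigma_finite : sigma_finite setT lebesgue_cons.
Proof.
have /sigma_finiteP[A [TA ndA Aoo]] := sigma_finiteT (@lebesgue_measure R).
have /sigma_finiteP[B [TB ndB Boo]] := sigma_finiteT m.
pose u (x : n.+1.-tuple R) : R * n.-tuple R := (thead x, [tuple of behead x]).
have mu : measurable_fun setT u.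
  by apply/measurable_fun_pair; [exact: measurable_tnth|exact: measurable_behead].
have uK : cancel (@consRd n) u.
  by case=> a v; congr pair; apply/val_inj.
exists (fun i => u @^-1` (A i `*` B i)) => [|i].
  apply/seteqP; split=> // x _.
  have [i _ Ai] : (\bigcup_i A i) (u x).1 by rewrite -TA.
  have [j _ Bj] : (\bigcup_j B j) (u x).2 by rewrite -TB.
  exists (maxn i j) => //; split.
  - by move: Ai; exact/subsetPset/ndA/leq_maxl.
  - by move: Bj; exact/subsetPset/ndB/leq_maxr.
have [mA Ai] := Aoo i; have [mB Bi] := Boo i; split.
  by rewrite -[X in measurable X]setTI; apply: mu => //; exact: measurableX.
rewrite /lebesgue_cons /pushforward (_ : _ @^-1` _ = A i `*` B i); last first.
  by apply/funext => z; rewrite -comp_preimage /preimage/= -[in RHS](uK z).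
by rewrite product_measure1E// lte_mul_pinfty// ge0_fin_numE.
Qed.

HB.instance Definition _ := @Measure_isSigmaFinite.Build _ _ _ lebesgue_cons
  lebesgue_cons_sigma_finite.

End step.

Fixpoint lebesgue_Rd (d : nat) : {sigma_finite_measure set (d.-tuple R) -> \bar R} :=
  match d with
  | 0 => \d_[tuple]
  | n.+1 => lebesgue_cons (lebesgue_Rd n)
  end.

End lebesgue_Rd.

Section euclidean.
Context {R : realType} {d : nat}.
Implicit Types x y : d.-tuple R.

Definition subRd x y : d.-tuple R := [tuple tnth x i - tnth y i | i < d].

Definition normRd x : R := Num.sqrt (\sum_(i < d) tnth x i ^+ 2).

End euclidean.

Section filtered_space.
Context {R : realType} {dO : measure_display} {Omega : measurableType dO}.
Variable P : probability Omega R.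

(* F t is the sigma-algebra at time t >= 0; its values at t < 0 are irrelevant. *)
Definition filtration (F : R -> set_system Omega) : Prop :=
  (forall t, 0 <= t -> sigma_algebra setT (F t) /\ F t `<=` measurable) /\
  (forall s t, 0 <= s -> s <= t -> F s `<=` F t).

Definition measurable_wrt {dV} {V : measurableType dV}
    (G : set_system Omega) (X : Omega -> V) : Prop :=
  forall C, measurable C -> G (X @^-1` C).

Definition cvg_prob0 (X : nat -> Omega -> \bar R) : Prop :=
  forall e : R, 0 < e ->
    (fun n => P [set w | e%:E <= `|X n w|]%E) @ \oo --> 0%E.

Variable F : R -> set_system Omega.

(* A random field over (0,oo) x U is written as a map on the Borel sets of
   R x U, of which only those contained in {t > 0} matter.  The second clause
   says at once that the values on disjoint sets are independent (E := setT,
   s := 0) and that the field on (s,oo) x U is independent of F s. *)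
Definition independently_scattered {dU} {U : measurableType dU}
    {dV} {V : measurableType dV} (ref : set (R * U) -> \bar R)
    (M : set (R * U) -> Omega -> V) : Prop :=
  (forall t A, 0 <= t -> measurable A -> (ref A < +oo)%E ->
     A `<=` `]0, t] `*` setT -> measurable_wrt (F t) (M A)) /\
  (forall s E n (A : 'I_n -> set (R * U)) (C : 'I_n -> set V),
     0 <= s -> F s E ->
     (forall i, [/\ measurable (A i), (ref (A i) < +oo)%E &
                    A i `<=` `]s, +oo[ `*` setT]) ->
     (forall i j, i != j -> A i `&` A j = set0) ->
     (forall i, measurable (C i)) ->
     P (E `&` \bigcap_i (M (A i) @^-1` C i)) =
     (P E * \prod_(i < n) P (M (A i) @^-1` C i))%E).

(* The law N(0, v); normal_prob does not cover v = 0. *)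
Definition centered_gaussian (v : R) (X : Omega -> R) : Prop :=
  if v == 0 then {ae P, forall w, X w = 0}
  else forall C, measurable C -> P (X @^-1` C) = normal_prob 0 (Num.sqrt v) C.

(* The law Poisson(v); poisson_pmf v is not a mass function for v = 0. *)
Definition poisson_distributed (v : R) (X : Omega -> \bar R) : Prop :=
  forall k : nat,
    P [set w | X w = k%:R%:E] = (v ^+ k / k`!%:R * expR (- v))%:E.

Definition white_noise {d} (W : set (R * d.-tuple R) -> Omega -> R) : Prop :=
  let leb := (lebesgue_measure \x lebesgue_Rd d)%E in
  let dom := [set A : set (R * d.-tuple R) |
    [/\ measurable A, (leb A < +oo)%E & A `<=` `]0, +oo[ `*` setT]] in
  [/\ forall A, dom A ->
        measurable_fun setT (W A) /\ centered_gaussian (fine (leb A)) (W A),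
      forall A B, dom A -> dom B -> A `&` B = set0 ->
        {ae P, forall w, W (A `|` B) w = W A w + W B w}
    & independently_scattered leb W].

Definition intensity d (lam : {sigma_finite_measure set R -> \bar R}) :
    set (R * (d.-tuple R * R)) -> \bar R :=
  (lebesgue_measure \x (lebesgue_Rd d \x lam))%E.

Definition poisson_random_measure {d}
    (lam : {sigma_finite_measure set R -> \bar R})
    (mu : R.-ker Omega ~> (R * (d.-tuple R * R))%type) : Prop :=
  (forall A, measurable A -> (intensity lam A < +oo)%E ->
     A `<=` `]0, +oo[ `*` setT ->
     poisson_distributed (fine (intensity lam A)) (mu ^~ A)) /\
  independently_scattered (@intensity d lam) (fun A w => mu w A).

End filtered_space.

(* Every measure integrating min(1, z^2) with no mass at 0 is sigma-finite, so
   the type of lam is no restriction. *)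
Definition levy_measure {R : realType}
    (lam : {sigma_finite_measure set R -> \bar R}) : Prop :=
  lam [set 0] = 0%E /\ (\int[lam]_z (Num.min 1 (z ^+ 2))%:E < +oo)%E.

Definition m_lambda {R : realType}
    (lam : {sigma_finite_measure set R -> \bar R}) (p : R) : \bar R :=
  poweR (\int[lam]_z (`|z| `^ p)%:E)%E p^-1.

Section stochastic_integral.
Context {R : realType} {dO : measure_display} {Omega : measurableType dO}.
Variables (P : probability Omega R) (F : R -> set_system Omega).

(* coef(w) 1_{]lo, hi]}(s) 1_mark(u) *)
Record elementary {dU} (U : measurableType dU) := Elementary {
  coef : Omega -> R;
  lo : R;
  hi : R;
  mark : set U }.

Section integral.
Context {dU : measure_display} {U : measurableType dU}.
Variables (m : set U -> \bar R) (T : R).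

Definition elementary_predictable (e : elementary U) : Prop :=
  [/\ 0 <= lo e <= hi e, hi e <= T, measurable (mark e) /\ (m (mark e) < +oo)%E,
      measurable_wrt (F (lo e)) (coef e) &
      exists K, forall w, `|coef e w| <= K].

Definition elementary_eval k (S : 'I_k -> elementary U) (w : Omega) (s : R) (u : U) : R :=
  \sum_(i < k) coef (S i) w * \1_(`]lo (S i), hi (S i)]) s * \1_(mark (S i)) u.

Definition elementary_integral (M : set (R * U) -> Omega -> R)
    k (S : 'I_k -> elementary U) (w : Omega) : R :=
  \sum_(i < k) coef (S i) w * M (`]lo (S i), hi (S i)] `*` mark (S i)) w.

(* I is a version of the Ito integral of G over ]0, T] x U against M: the limit
   in probability of elementary integrals whose integrands approximate G in the
   sense that int_0^T int_U phi(S_n - G) dm ds -> 0 in probability. *)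
Definition is_stochastic_integral (phi : R -> R) (M : set (R * U) -> Omega -> R)
    (G : Omega -> R -> U -> R) (I : Omega -> R) : Prop :=
  measurable_fun setT I /\
  exists (k : nat -> nat) (S : forall n, 'I_(k n) -> elementary U),
    [/\ forall n i, elementary_predictable (S n i),
        cvg_prob0 P (fun n w =>
          (\int[lebesgue_measure \x m]_(z in `]0%R, T] `*` setT)
             (phi (elementary_eval (@S n) w z.1 z.2 - G w z.1 z.2))%:E)%E)
      & cvg_prob0 P (fun n w => (elementary_integral M (@S n) w - I w)%:E)].

End integral.

Context {d : nat}.
Implicit Types (lam : {sigma_finite_measure set R -> \bar R})
  (W : set (R * d.-tuple R) -> Omega -> R)
  (mu : R.-ker Omega ~> (R * (d.-tuple R * R))%type)
  (H : Omega -> R -> d.-tuple R -> R).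

Definition is_gaussian_integral W (T : R) H (I : Omega -> R) : Prop :=
  is_stochastic_integral (lebesgue_Rd d) T (fun r => r ^+ 2) W H I.

Definition compensated lam mu (A : set (R * (d.-tuple R * R))) (w : Omega) : R :=
  fine (mu w A - intensity lam A)%E.

(* phi(r) = min(|r|, r^2) is the modular of the integrands that are locally
   integrable against mu - nu: an L^2 control of the small values and an L^1
   control of the large ones. *)
Definition is_compensated_integral lam mu (T : R)
    (G : Omega -> R -> d.-tuple R * R -> R) (I : Omega -> R) : Prop :=
  is_stochastic_integral (lebesgue_Rd d \x lam)%E T
    (fun r => Num.min `|r| (r ^+ 2)) (compensated lam mu) G I.

(* The integral of H over ]0, T] x R^d against
   Lambda = b dt dx + rho W(dt, dx) + int z (mu - nu)(dt, dx, dz).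
   The constants are kept inside the integrands, so that no integrability
   against W is required when rho = 0. *)
Definition is_noise_integral (b rho : R) W lam mu (T : R) H (I : Omega -> R) : Prop :=
  let leb := (lebesgue_measure \x lebesgue_Rd d)%E in
  let dom := `]0, T] `*` [set: d.-tuple R] in
  exists IW J : Omega -> R,
    [/\ is_gaussian_integral W T (fun w s y => rho * H w s y) IW,
        is_compensated_integral lam mu T (fun w s u => H w s u.1 * u.2) J,
        {ae P, forall w, leb.-integrable dom (fun z => (b * H w z.1 z.2)%:E)}
      & {ae P, forall w,
          I w = (\int[leb]_(z in dom) (b * H w z.1 z.2)) + IW w + J w}].

End stochastic_integral.

Section heat_equation.
Context {R : realType} {d : nat} {dO : measure_display} {Omega : measurableType dO}.
Variables (P : probability Omega R) (F : R -> set_system Omega).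
Implicit Types (f : d.-tuple R -> R) (Y : R -> d.-tuple R -> Omega -> R).

Definition heat_kernel (kappa t : R) (x : d.-tuple R) : R :=
  (2 * pi * kappa * t) `^ (- (d%:R / 2)) *
  expR (- (normRd x ^+ 2 / (2 * kappa * t))).

Definition heat_init kappa f (t : R) (x : d.-tuple R) : R :=
  \int[lebesgue_Rd d]_(y in setT) (heat_kernel kappa t (subRd x y) * f y).

(* Y is measurable on Omega x (0,oo) x R^d for the product of the predictable
   sigma-algebra on Omega x (0,oo) and the Borel sigma-algebra of R^d. *)
Definition predictable Y : Prop :=
  let D := [set z : Omega * (R * d.-tuple R) | 0 < z.2.1] in
  let rectangles := [set A | exists s t E B,
    [/\ 0 <= s, s <= t, F s E, measurable B & A = E `*` (`]s, t] `*` B)]] in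
  forall C : set R, measurable C ->
    <<s D, rectangles >> (D `&` [set z | C (Y z.2.1 z.2.2 z.1)]).

(* The value of the integrand at s = t is irrelevant, {t} x R^d being null. *)
Definition mild_solution (kappa b rho : R)
    (W : set (R * d.-tuple R) -> Omega -> R)
    (lam : {sigma_finite_measure set R -> \bar R})
    (mu : R.-ker Omega ~> (R * (d.-tuple R * R))%type)
    (f : d.-tuple R -> R) (sigma : R -> R) Y : Prop :=
  predictable Y /\
  forall t x, 0 < t -> exists I : Omega -> R,
    is_noise_integral P F b rho W lam mu t
      (fun w s y => heat_kernel kappa (t - s) (subRd x y) * sigma (Y s y w)) I /\
    {ae P, forall w, Y t x w = heat_init kappa f t x + I w}.

Definition moment (p : R) Y (t : R) (x : d.-tuple R) : \bar R :=
  'E_P[fun w => `|Y t x w| `^ p].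

Definition weighted_norm (p c beta : R) Y : \bar R :=
  ereal_sup [set ((expR (- beta * t + c * normRd x))%:E *
                  poweR (moment p Y t x) p^-1)%E
            | t in [set t : R | (0 < t)%R] & x in [set: d.-tuple R]].

(* The class in which the mild solution exists and is unique up to
   modifications. *)
Definition in_uniqueness_class (p c : R) Y : Prop :=
  exists2 beta0 : R, 0 < beta0 &
    forall beta, beta0 <= beta -> (weighted_norm p c beta Y < +oo)%E.

Definition upper_rate (p : R) Y (D : R -> set (d.-tuple R)) : \bar R :=
  limf_esup (fun t : R =>
    ((t^-1)%:E * ereal_sup [set lne (moment p Y t x) | x in D t])%E)
    (pinfty_nbhs R).

Definition gamma_upper (p : R) Y : \bar R := upper_rate p Y (fun=> setT).

Definition lambda_upper (p : R) Y : \bar R :=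
  ereal_inf [set a%:E | a in [set a : R | (0 < a)%R /\
    (upper_rate p Y (fun t => [set x | (a * t <= normRd x)%R]) < 0)%E]].

End heat_equation.

(* Main.v *)
(* The solution lives in a class in which its weighted L^p norm is finite, i.e.
   E|Y(t,x)|^p <= C^p exp (p (beta t - c |x|)).  Bounding -c |x| by 0 gives the
   upper moment Lyapunov exponent at most p beta; on the region |x| >= a t with
   a = (beta + 1) / c the exponent is at most - p t, so the growth index is at
   most a. *)

Require Import Defs.
From HB Require Import structures.
From mathcomp Require Import all_boot all_order all_algebra.
From mathcomp Require Import all_classical all_reals all_analysis.
From mathcomp Require Import measurable_realfun.
From mathcomp Require Import lra.

Import Order.TTheory GRing.Theory Num.Theory.
Import numFieldNormedType.Exports.

Local Open Scope classical_set_scope.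
Local Open Scope ring_scope.

(** The point [(t, x)] contributes one term to the supremum [weighted_norm]; taking logarithms of
    the bound on that term makes it affine in [t] and [normRd x]. *)
Lemma lne_moment_le (R : realType) (d : nat) (dO : measure_display)
    (Omega : measurableType dO) (P : probability Omega R)
    (Y : R -> d.-tuple R -> Omega -> R) (p c beta C t : R) (x : d.-tuple R) :
  0 < p -> 0 < C -> (weighted_norm P p c beta Y <= C%:E)%E -> 0 < t ->
  (lne (moment P p Y t x) <= (p * (ln C + beta * t - c * normRd x))%:E)%E.
Proof.
move=> p0 C0 YC t0.
have : ((expR (- beta * t + c * normRd x))%:E *
        poweR (moment P p Y t x) p^-1 <= C%:E)%E.
  apply: le_trans YC; apply: ereal_sup_ubound.
  by exists t => //; exists x.
(* A real moment [r <= 0] has [lne] equal to [-oo]; an infinite moment would make the weighted term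
   infinite, against the bound [C]. *)
case: (moment P p Y t x) => [r| |] /=; last by rewrite leNye.
- case: ifPn => [_ _|]; first by rewrite leNye.
  rewrite -ltNge => r0; rewrite -EFinM !lee_fin => rC.
  rewrite -ler_pdivrMl//.
  have : ln (expR (- beta * t + c * normRd x) * r `^ p^-1) <= ln C.
    by rewrite ler_ln// posrE mulr_gt0 ?expR_gt0 ?powR_gt0.
  rewrite lnM ?posrE ?expR_gt0 ?powR_gt0// expRK ln_powR.
  lra.
- by rewrite invr_eq0 gt_eqF// gt0_muley ?lte_fin ?expR_gt0// leye_eq.
Qed.

(** After division by [t] the intercept contributes [A / t], which the slack [e] absorbs for large
    [t]. *)
Lemma upper_rate_le (R : realType) (d : nat) (dO : measure_display)
    (Omega : measurableType dO) (P : probability Omega R)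
    (Y : R -> d.-tuple R -> Omega -> R) (p A B e : R)
    (D : R -> set (d.-tuple R)) :
  0 < e ->
  (forall t x, 0 < t -> D t x -> (lne (moment P p Y t x) <= (A + B * t)%:E)%E) ->
  (upper_rate P p Y D <= (B + e)%:E)%E.
Proof.
(* From [t0] on, [|A| <= e * t]; the added 1 keeps [t0] positive when [A = 0]. *)
move=> e0 YAB; pose t0 := `|A| / e + 1.
(* The limsup is an infimum of suprema over neighbourhoods of infinity, so one half-line bounds
   it. *)
apply: le_trans (ereal_inf_lbound _) _.
  by exists [set t | t0 <= t] => //; exact: nbhs_pinfty_ge (num_real _).
apply: ge_ereal_sup => _ [t /= t0t <-].
have tpos : 0 < t by rewrite (lt_le_trans _ t0t)// /t0 ltr_wpDl// divr_ge0// ltW.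
apply: (@le_trans _ _ ((t^-1)%:E * (A + B * t)%:E)%E).
  rewrite lee_pmul2l ?lte_fin ?invr_gt0//.
  by apply: ge_ereal_sup => _ [x Dx <-]; exact: YAB.
rewrite -EFinM lee_fin ler_pdivrMl// (mulrC t) mulrDl addrC lerD2l.
rewrite (le_trans (ler_norm A))// mulrC -ler_pdivrMr//.
by rewrite (le_trans _ t0t)// /t0 lerDl.
Qed.

Theorem theorem2p4 (R : realType) (d : nat) (d_gt0 : (0 < d)%N)
    (dO : measure_display) (Omega : measurableType dO) (P : probability Omega R)
    (F : R -> set_system Omega) (F_filtration : filtration F)
    (b rho : R)
    (W : set (R * d.-tuple R) -> Omega -> R) (W_noise : white_noise P F W)
    (lam : {sigma_finite_measure set R -> \bar R}) (lam_levy : levy_measure lam)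
    (mu : R.-ker Omega ~> (R * (d.-tuple R * R))%type)
    (mu_poisson : poisson_random_measure P F lam mu)
    (kappa : R) (kappa_gt0 : 0 < kappa)
    (c : R) (c_ge0 : 0 <= c)
    (f : d.-tuple R -> R) (f_meas : measurable_fun setT f)
    (f_bounded : exists K, forall x, `|f x| <= K)
    (f_decay : exists K r, forall x,
      r <= normRd x -> `|f x| <= K * expR (- c * normRd x))
    (sigma : R -> R) (sigma_lipschitz : lipschitz sigma)
    (sigma0 : 0 < c -> sigma 0 = 0)
    (p : R) (p_ge1 : 1 <= p) (p_lt : p < 1 + 2 / d%:R)
    (lam_moment : (m_lambda lam p < +oo)%E)
    (rho0 : p < 2 -> rho = 0)
    (Y : R -> d.-tuple R -> Omega -> R)
    (Y_mild : mild_solution P F kappa b rho W lam mu f sigma Y)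
    (Y_class : in_uniqueness_class P p c Y) :
  (gamma_upper P p Y < +oo)%E /\
  (0 < c -> sigma 0 = 0 -> (lambda_upper P p Y < +oo)%E).
Proof.
have p0 : 0 < p by rewrite (lt_le_trans ltr01).
have normRd_ge0 (x : d.-tuple R) : 0 <= normRd x by exact: sqrtr_ge0.
case: Y_class => beta beta0 /(_ _ (lexx beta)) Yfin.
(* [C] must be positive for [ln C] to be meaningful, hence [|r| + 1]. *)
have [C C0 YC] : exists2 C : R, 0 < C & (weighted_norm P p c beta Y <= C%:E)%E.
  case: (weighted_norm P p c beta Y) Yfin => [r _| //|_].
  - exists (`|r| + 1); first by rewrite ltr_wpDl.
    by rewrite lee_fin (le_trans (ler_norm r))// lerDl.
  - by exists 1 => //; rewrite leNye.
have YE t x := lne_moment_le _ _ _ _ _ Y p c beta C t x p0 C0 YC.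
split=> [|c0 _].
(* Slack [e = 1]: any finite bound will do. *)
- apply: le_lt_trans (ltry (p * beta + 1)).
  apply: (upper_rate_le _ _ _ _ _ _ _ (p * ln C)) => // t x t0 _.
  apply: le_trans (YE t x t0) _; rewrite lee_fin -mulrA -mulrDr ler_pM2l//.
  by rewrite gerBl mulr_ge0.
- apply: le_lt_trans (ltry ((beta + 1) / c)).
  apply: ereal_inf_lbound; exists ((beta + 1) / c) => //; split.
    by rewrite divr_gt0// addr_gt0.
  (* Slack [e = p / 2] keeps the rate strictly negative, at most [- p / 2]. *)
  apply: (@le_lt_trans _ _ (- p + p / 2)%:E); last by rewrite lte_fin; lra.
  apply: (upper_rate_le _ _ _ _ _ _ _ (p * ln C)) => [|t x t0 /=]; first by rewrite divr_gt0.
  (* The region becomes [(beta + 1) * t <= c * normRd x], so [beta * t - c * normRd x <= - t]. *)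
  rewrite mulrAC ler_pdivrMr// mulrC => tx.
  apply: le_trans (YE t x t0) _; rewrite lee_fin mulNr -mulrBr ler_pM2l//.
  lra.
Qed.
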